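(* Let $k\ge 2$ and let $f:\mathbb V_n\to\mathbb Z_{2^k}$ be a gbent function, written as $f(\mathbf x)=a_1(\mathbf x)+2a_2(\mathbf x)+\cdots+2^{k-1}a_k(\mathbf x)$ with Boolean functions $a_i:\mathbb V_n\to\mathbb F_2$, $1\le i\le k$. Let $1\le s\le k$, and for $\mathbf c=(c_1,\ldots,c_{s-1})\in\mathbb F_2^{s-1}$ let $$g_{\mathbf c}=a_s+2a_{s+1}+\cdots+2^{k-s-1}a_{k-1}+2^{k-s}\left(\bigoplus_{i=1}^{s-1}c_ia_i\oplus a_k\right),$$ a function from $\mathbb V_n$ to $\mathbb Z_{2^{k-s+1}}$ (for $s=k$ this is the Boolean function $g_{\mathbf c}=\bigoplus_{i=1}^{k-1}c_ia_i\oplus a_k$). (1) If $n$ is even, or if $n$ is odd and $s<k$, then for every $\mathbf c\in\mathbb F_2^{s-1}$ the function $g_{\mathbf c}:\mathbb V_n\to\mathbb Z_{2^{k-s+1}}$ is gbent. Moreover, if $s\ge2$, then for all $c_1,\ldots,c_{s-2}\in\mathbb F_2$, with $\mathbf c_0=(c_1,\ldots,c_{s-2},0)$ and $\mathbf c_1=(c_1,\ldots,c_{s-2},1)$, one has for every $\mathbf u\in\mathbb V_n$ $$\mathcal H_{g_{\mathbf c_1}}(\mathbf u)=\pm\mathcal H_{g_{\mathbf c_0}}(\mathbf u),$$ where the sign may depend on $\mathbf u$. (2) If $n$ is odd and $s=k$ (hence $g_{\mathbf c}$ is Boolean), then $g_{\mathbf c}$ is semibent for every $\mathbf c\in\mathbb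 F_2^{s-1}$.
   Context: $\mathbb V_n$ is an $n$-dimensional vector space over $\mathbb F_2$ with a fixed nondegenerate inner product $\langle\cdot,\cdot\rangle$ (e.g. $\mathbb F_2^n$ with the dot product). Values of Boolean functions are read as the integers $0,1$ when multiplied by powers of $2$ and added; $\oplus$ is addition in $\mathbb F_2$. For $F:\mathbb V_n\to\mathbb Z_{2^r}$ the generalized Walsh-Hadamard transform is $$\mathcal H_F(\mathbf u)=\mathcal H_F^{(2^r)}(\mathbf u)=\sum_{\mathbf x\in\mathbb V_n}\zeta_{2^r}^{F(\mathbf x)}(-1)^{\langle\mathbf u,\mathbf x\rangle},\qquad \zeta_{2^r}=e^{2\pi i/2^r},$$ and $F$ is called gbent (generalized bent) if $|\mathcal H_F(\mathbf u)|=2^{n/2}$ for all $\mathbf u\in\mathbb V_n$. For $n$ odd, a Boolean function $g:\mathbb V_n\to\mathbb F_2$ is called semibent if $\left|\sum_{\mathbf x\in\mathbb V_n}(-1)^{g(\mathbf x)+\langle\mathbf u,\mathbf x\rangle}\right|\in\{0,2^{(n+1)/2}\}$ for all $\mathbf u\in\mathbb V_n$. *)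

(* Defs.v *)
From HB Require Import structures.
From mathcomp Require Import all_boot all_order all_algebra all_field.
From mathcomp Require Import complex.
From mathcomp Require Import reals exp trigo.

Set Implicit Arguments.
Unset Strict Implicit.
Unset Printing Implicit Defensive.

Import Order.TTheory GRing.Theory Num.Theory.
Local Open Scope ring_scope.
Local Open Scope complex_scope.

(* e^(2 pi i / 2^r) *)
Definition zeta (R : realType) (r : nat) : R[i] :=
  cos (2 * pi / 2 ^+ r) +i* sin (2 * pi / 2 ^+ r).

(* [finvect_type V] is the finite type carried by the vector space V over 'F_2.
   Elements of 'Z_m and 'F_2 used as exponents are read as their canonical
   representatives in nat; here r >= 1 is intended, since 'Z_1 is Z/2. *)
Definition gWHT (R : realType) (V : vectType 'F_2) (ip : V -> V -> 'F_2)
    (r : nat) (F : V -> 'Z_(2 ^ r)) (u : V) : R[i] :=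
  \sum_(x : finvect_type V) zeta R r ^+ F x * (-1) ^+ ip u x.

Definition gbent (R : realType) (V : vectType 'F_2) (ip : V -> V -> 'F_2)
    (r : nat) (F : V -> 'Z_(2 ^ r)) : Prop :=
  forall u : V,
    `|gWHT R ip F u| = (2 `^ ((\dim {:V})%:R / 2))%:C :> R[i].

(* Meaningful for odd \dim {:V}. *)
Definition semibent (V : vectType 'F_2) (ip : V -> V -> 'F_2)
    (g : V -> 'F_2) : Prop :=
  forall u : V,
    let W : int := \sum_(x : finvect_type V) (-1) ^+ (g x + ip u x)%R in
    `|W| = 0 \/ `|W| = 2 ^+ (\dim {:V}).+1./2.

(* Tuples (a_1, ..., a_k) and (c_1, ..., c_(s-1)) are numbered from 1. *)
Definition acoord (V : Type) (a : seq (V -> 'F_2)) (i : nat) : V -> 'F_2 :=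
  nth (fun _ => 0) a i.-1.

Definition ccoord (c : seq 'F_2) (i : nat) : 'F_2 := nth 0 c i.-1.

(* a_1 + 2 a_2 + ... + 2^(k-1) a_k, bits being read in nat *)
Definition of_bits (V : Type) (k : nat) (a : seq (V -> 'F_2)) (x : V) :
    'Z_(2 ^ k) :=
  (\sum_(1 <= i < k.+1) 2 ^ (i - 1) * acoord a i x)%N%:R.

(* c_1 a_1 + ... + c_(s-1) a_(s-1) + a_k in 'F_2 *)
Definition top_bit (V : Type) (k s : nat) (a : seq (V -> 'F_2))
    (c : seq 'F_2) (x : V) : 'F_2 :=
  \sum_(1 <= i < s) ccoord c i * acoord a i x + acoord a k x.

Definition gcomp (V : Type) (k s : nat) (a : seq (V -> 'F_2))
    (c : seq 'F_2) (x : V) : 'Z_(2 ^ (k - s + 1)) :=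
  (\sum_(s <= i < k) 2 ^ (i - s) * acoord a i x
     + 2 ^ (k - s) * top_bit k s a c x)%N%:R.

(* The Boolean function x |-> F x mod 2; it identifies 'Z_(2 ^ 1) with 'F_2
   without a cast, for F valued in 'Z_(2 ^ r) where r is only provably 1. *)
Definition as_boolean (V : Type) (r : nat) (F : V -> 'Z_(2 ^ r)) (x : V) :
    'F_2 := (F x : nat)%:R.

Lemma as_boolean_gcomp (V : Type) (k : nat) (a : seq (V -> 'F_2))
    (c : seq 'F_2) (x : V) :
  as_boolean (gcomp k k a c) x = top_bit k k a c x.
Proof.
rewrite /as_boolean /gcomp big_geq // subnn expn0 mul1n add0n.
move: (top_bit _ _ _ _ _) => b; apply: val_inj.
by case: b => [[|[|m]] hm].
Qed.

(* Main.v *)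
Require Import Defs.
From mathcomp Require Import all_boot all_order all_algebra all_field.
From mathcomp Require Import complex reals exp trigo.
From mathcomp Require Import ring zify.

Import Order.TTheory GRing.Theory Num.Theory.
Local Open Scope ring_scope.

(* Grouping the points x by the low bits j = a_1 + 2 a_2 + ... + 2^(k-2) a_(k-1)
   writes H_f(u) = \sum_(j < N) S_j z^j with N = 2^(k-1), z = e^(2 pi i / 2^k)
   and integers S_j; likewise
   H_(g_c)(u) = \sum_j S_j (-1)^(c . j) z'^(j %/ 2^(s-1)), with the same S_j.
   The powers 1, z, ..., z^(N-1) are linearly independent over Q by Eisenstein's
   criterion, and 1 - z generates the only prime of Z[z] above 2. As
   |H_f(u)|^2 = 2^n, it follows that 2^(n./2) divides H_f(u), and hence every
   S_j. After this division the constant coefficient of |H_f(u)|^2 is a sum of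
   squares equal to 1 (n even) or 2 (n odd). So only one S_j is nonzero
   if n is even, and only two are if n is odd, both equal to 2^(n./2) up to sign;
   vanishing of the other coefficients forces their indices to differ by N / 2,
   that is in the bit a_(k-1) only. This leaves one or two terms in each
   H_(g_c)(u). *)

(** * Elements of Z[z] of absolute value 2^(n/2) *)

(** Squaring is additive modulo 2. Used with [x = 'X] for Eisenstein and with [x = - 'X] for the
    powers of [1 - z]. *)
Lemma exprD1_pow2 (A : comNzRingType) (m : nat) (x : A) :
  exists h : A, (x + 1) ^+ (2 ^ m) = x ^+ (2 ^ m) + 1 + 2 * h.
Proof.
elim: m => [|m [h IHm]]; first by exists 0; rewrite !expr1 mulr0 addr0.
exists (x ^+ (2 ^ m) * (1 + 2 * h) + 2 * h + 2 * h ^+ 2).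
rewrite expnS mulnC !exprM IHm; ring.
Qed.

Lemma size_XD1_exp (n : nat) : size (('X + 1 : {poly int}) ^+ n) = n.+1.
Proof. by rewrite -[1]opprK -polyCN size_exp_XsubC. Qed.

Lemma size_XD1_expD1 (n : nat) :
  (0 < n)%N -> size (('X + 1) ^+ n + 1 : {poly int}) = n.+1.
Proof. by move=> n0; rewrite size_polyDl size_XD1_exp // size_poly1. Qed.

(** Eisenstein at 2: the constant term is 2, and by [exprD1_pow2] the polynomial is ['X^(2 ^ m)]
    modulo 2. *)
Lemma eisenstein_XD1_pow2 (m : nat) :
  irreducible_poly (('X + 1) ^+ (2 ^ m) + 1 : {poly int}).
Proof.
set q := (X in irreducible_poly X).
have mon : ('X + 1 : {poly int}) ^+ (2 ^ m) \is monic.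
  by rewrite monic_exp // -[1]opprK -polyCN monicXsubC.
have szq : size q = (2 ^ m).+1 by rewrite size_XD1_expD1 // expn_gt0.
have q0 : q`_0 = 2.
  by rewrite -horner_coef0 /q !hornerE /= expr1n.
apply: (@eisenstein_crit 2) => //.
- by rewrite szq eqSS -lt0n expn_gt0.
- by rewrite lead_coefDl ?(monicP mon) // size_XD1_exp size_poly1 ltnS expn_gt0.
- by rewrite q0.
move=> i; rewrite szq /= => lti.
have [h Dh] := exprD1_pow2 _ m ('X : {poly int}).
have -> : q = 'X^(2 ^ m) + 2%:P * (1 + h) by rewrite /q Dh polyC_natr; ring.
by rewrite coefD coefXn (ltn_eqF lti) add0r coefCM dvdz_mulr.
Qed.

(** The total is at most 2, so a nonzero term can only be 1. Removing it leaves a sum of the same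
    shape, so a total of 2 allows a second application. *)
Lemma sum_sqr_int_pick (I : finType) (P : pred I) (x : I -> int) (c : nat) :
  (c < 2)%N -> \sum_(i | P i) x i ^+ 2 = c.+1%:R ->
  exists i, exists b : bool, [/\ P i, x i = (-1) ^+ b
                              & \sum_(j | P j && (j != i)) x j ^+ 2 = c%:R].
Proof.
move=> lt_c2 Ex.
have [i /andP[Pi xi0]|x0] := pickP (fun i => P i && (x i != 0)); last first.
  move: Ex; rewrite big1 => [/eqP|i Pi]; first by rewrite eq_sym pnatr_eq0.
  by move: (x0 i); rewrite Pi => /negbFE/eqP ->; rewrite expr0n.
exists i; move: Ex; rewrite (bigD1 i) //=.
set S := \sum_(j | _) _.
have S0 : 0 <= S by apply: sumr_ge0 => j _; rewrite sqr_ge0.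
move=> Ex.
have xi1 : x i ^+ 2 = 1.
  have : x i ^+ 2 <= 2.
    by apply: (@le_trans _ _ c.+1%:R); [rewrite -Ex lerDl | rewrite ler_nat].
  have : 0 < x i ^+ 2 by rewrite exprn_even_gt0.
  move: xi0; rewrite !expr2; move: (x i) => y y0 y_gt0 y_le2.
  have : -2 < y < 2 by nia.
  by move: y y0 {y_gt0 y_le2} => [[|[|[]]]|[|[]]].
move/eqP: (xi1); rewrite sqrf_eq1 => xi.
exists (x i == -1); split=> //.
  by case/orP: xi => /eqP ->.
by move: Ex; rewrite xi1 -natr1 addrC => /addIr.
Qed.

Section CyclotomicIntegers.

Variables (C : numClosedFieldType) (z : C) (m : nat).
Hypothesis zN1 : z ^+ (2 ^ m) = -1.

Local Notation N := (2 ^ m)%N.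
Local Notation ev p := ((map_poly intr p).[z]).

(** After the shift by 1, [p'] shares the root [z - 1] with the irreducible [q], so [q] divides [p']
    over the rationals; the degrees force [p' = 0]. *)
Lemma horner_intr_inj (p : {poly int}) : (size p <= N)%N -> ev p = 0 -> p = 0.
Proof.
move=> szp pz0.
pose q : {poly int} := ('X + 1) ^+ N + 1.
pose p' := p \Po ('X + 1).
have irrq := eisenstein_XD1_pow2 m.
have szp' : size p' = size p.
  by rewrite /p' -[1]opprK -polyCN size_comp_poly2 // size_XsubC.
have szq : size q = N.+1 by rewrite size_XD1_expD1 // expn_gt0.
pose QC : {poly rat} -> {poly C} := map_poly ratr.
pose ZQ : {poly int} -> {poly rat} := map_poly intr.
have ZC (g : {poly int}) : QC (ZQ g) = map_poly intr g.
  rewrite /QC /ZQ -map_poly_comp; apply: eq_map_poly => i /=.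
  by rewrite ratr_int.
have ev1 : (map_poly intr p').[z - 1] = 0 :> C.
  rewrite map_comp_poly /= horner_comp rmorphD /= map_polyX rmorph1.
  by rewrite !hornerE subrK.
have root_q : root (map_poly intr q : {poly C}) (z - 1).
  rewrite /root /q !(rmorphD, rmorphXn, rmorph1) /= map_polyX.
  by rewrite !hornerE /= subrK zN1 addNr.
have : ~~ coprimep (ZQ q) (ZQ p').
  rewrite -(coprimep_map (ratr : {rmorphism rat -> C})) -!/(QC _) !ZC.
  by apply/negP => /coprimep_root/(_ root_q); rewrite ev1 eqxx.
have irrQ : irreducible_poly (ZQ q) by apply/irreducible_rat_int.
rewrite irreducible_poly_coprime // negbK => dv_q.
apply/eqP; rewrite -size_poly_eq0 -szp' -(size_rat_int_poly p') size_poly_eq0.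
apply: contraLR dv_q => nz; apply/negP => /dvdp_leq => /(_ nz).
by rewrite !size_rat_int_poly szq szp' leqNgt ltnS szp.
Qed.

Lemma pow2_gt0 : (0 < N)%N. Proof. by rewrite expn_gt0. Qed.

Lemma size_XnD1 : size ('X^N + 1 : {poly int}) = N.+1.
Proof. by rewrite -[1]opprK -polyCN size_XnsubC ?pow2_gt0. Qed.

Lemma horner_intr_XnD1 : ev ('X^N + 1 : {poly int}) = 0.
Proof. by rewrite rmorphD rmorph1 /= map_polyXn !hornerE /= zN1 addNr. Qed.

(** The divisor is monic, so division stays integral; every element of Z[z] gets a representative of
    size at most [N]. *)
Lemma divp_XnD1 (p : {poly int}) :
  exists d r : {poly int}, [/\ p = d * ('X^N + 1) + r, (size r <= N)%N
                             & ev r = ev p].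
Proof.
have mon : ('X^N + 1 : {poly int}) \is monic.
  by rewrite -[1]opprK -polyCN monicXnsubC ?pow2_gt0.
have Dp := Pdiv.RingMonic.rdivp_eq mon p.
set d := Pdiv.CommonRing.rdivp _ _ in Dp.
set r := Pdiv.CommonRing.rmodp _ _ in Dp.
exists d, r; split=> //.
  by have := Pdiv.CommonRing.ltn_rmodpN0 p (monic_neq0 mon); rewrite size_XnD1.
rewrite [in RHS]Dp rmorphD rmorphM /= hornerD hornerM horner_intr_XnD1.
by rewrite mulr0 add0r.
Qed.

(** By [horner_intr_inj] the difference is a multiple of ['X^N + 1], whose value at 1 is 2. *)
Lemma horner_intr_eq_mod2 (p q : {poly int}) :
  ev p = ev q -> (2 %| p.[1] - q.[1])%Z.
Proof.
move=> Epq; have [d [r [Dr szr Er]]] := divp_XnD1 (p - q).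
have r0 : r = 0.
  apply: horner_intr_inj szr _.
  by rewrite Er rmorphB hornerD hornerN /= Epq subrr.
rewrite -hornerN -hornerD Dr r0 addr0 hornerM !hornerE /= expr1n.
by rewrite dvdz_mull.
Qed.

Lemma mul_conj_root : z * z^* = 1.
Proof.
have /eqP : `|z| ^+ N = 1 by rewrite -normrX zN1 normrN1.
by rewrite pexpr_eq1 ?pow2_gt0 // -normCK => /eqP ->; rewrite expr1n.
Qed.

Lemma root_neq0 : z != 0.
Proof.
by apply: contra_eqN mul_conj_root => /eqP ->; rewrite mul0r eq_sym oner_eq0.
Qed.

Lemma conj_root : z^* = z ^+ (N.*2.-1).
Proof.
apply: (mulfI root_neq0).
rewrite mul_conj_root -exprS prednK ?double_gt0 ?pow2_gt0 //.
by rewrite -muln2 exprM zN1 sqrrN expr1n.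
Qed.

(** Conjugation amounts to substituting a power of ['X], and this keeps the value at 1. *)
Lemma horner_intr_conj (p : {poly int}) :
  exists2 q : {poly int}, ev q = (ev p)^* & q.[1] = p.[1].
Proof.
exists (p \Po 'X^(N.*2.-1)); last by rewrite horner_comp hornerXn expr1n.
rewrite map_comp_poly /= horner_comp map_polyXn hornerXn -conj_root.
rewrite -horner_map -map_poly_comp; congr (_.[_]).
by apply: eq_map_poly => i /=; rewrite rmorph_int.
Qed.

(** Modulo ['X - 1], [p] is its even value at 1, and [2 = 1 - z ^+ N] is itself a multiple of
    [1 - z]. *)
Lemma horner_even_pi_dvd (p : {poly int}) :
  (2 %| p.[1])%Z -> exists q : {poly int}, ev p = (1 - z) * ev q.
Proof.
case/dvdzP=> c Dc.
have /factor_theorem[q Dq] : root (p - p.[1]%:P) 1.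
  by rewrite /root !hornerE subrr.
exists (c%:P * \sum_(i < N) 'X^i - q).
have -> : p = q * ('X - 1%:P) + (c * 2)%:P by rewrite -Dc -Dq subrK.
have two : 2 = (1 - z) * \sum_(i < N) z ^+ i.
  by apply: oppr_inj; rewrite -mulNr opprB -subrX1 zN1; ring.
have evS : ev (\sum_(i < N) 'X^i) = \sum_(i < N) z ^+ i.
  rewrite rmorph_sum horner_sum; apply: eq_bigr => i _ /=.
  by rewrite map_polyXn hornerXn.
rewrite !(rmorphD, rmorphM, rmorphB, rmorphN) /= !map_polyC map_polyX /=.
rewrite !(hornerD, hornerM, hornerN, hornerX, hornerC) evS.
rewrite mulr1z [RHS]mulrBr mulrCA -two; ring.
Qed.

Hypothesis m_gt0 : (0 < m)%N.

(** As [N] is even, [(1 - 'X) ^+ N = 'X^N + 1 + 2 * h]. At [z] the first part vanishes; at 1 the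
    left side does, whence [h.[1] = -1]. So the cofactor [ev a] is odd and does not affect parity
    arguments. *)
Lemma two_dvd_pi_pow :
  exists2 a : {poly int}, (1 - z) ^+ N = 2 * ev a & a.[1] = -1.
Proof.
have [h Dh] := exprD1_pow2 _ m (- 'X : {poly int}).
have evenN : ~~ odd N by rewrite oddX negb_or -lt0n m_gt0.
rewrite exprNn -signr_odd (negbTE evenN) mul1r in Dh.
exists h.
  have := congr1 (fun p => ev p) Dh.
  rewrite addrC rmorphXn rmorphB rmorph1 /= map_polyX !hornerE => ->.
  rewrite rmorphD rmorphM /= !hornerE horner_intr_XnD1 add0r.
  by rewrite rmorphMn rmorph1 /= hornerMn hornerC.
have /eqP := congr1 (fun p => p.[1]) Dh.
rewrite !hornerE /= expr1n addNr expr0n gtn_eqF ?pow2_gt0 //.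
have -> : 1 + 1 + (1 + 1) * h.[1] = 2 * (h.[1] + 1) by ring.
by rewrite eq_sym mulf_eq0 pnatr_eq0 orFb addr_eq0 => /eqP.
Qed.

(* p |-> p(1) mod 2 is a well-defined ring morphism from Z[z] to F_2, invariant
   under conjugation, and it kills 1 - z. So if ev p = (1 - z)^j (ev q) with
   2 j < n N, cancelling (1 - z)^(2 j) in |ev p|^2 = 2^n gives q(1)^2 = 0 mod 2,
   i.e. 1 - z also divides ev q. *)
Lemma pi_pow_dvd (n : nat) (p : {poly int}) (j : nat) :
  `|ev p| ^+ 2 = 2 ^+ n -> (j.*2 <= n * N)%N ->
  exists q : {poly int}, ev p = (1 - z) ^+ j * ev q.
Proof.
move=> normp; elim: j => [|j IHj] lej; first by exists p; rewrite mul1r.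
have ltj : (j.*2 < n * N)%N by apply: leq_trans lej; rewrite doubleS.
have [q Dq] := IHj (ltnW ltj).
suff /horner_even_pi_dvd[q' Dq'] : (2 %| q.[1])%Z.
  by exists q'; rewrite Dq Dq' mulrA -exprSr.
have [qc Dqc qc1] := horner_intr_conj q.
have [a Da a1] := two_dvd_pi_pow.
have pi0 : 1 - z != 0.
  apply: contra_eqN zN1 => /eqP/subr0_eq <-.
  by rewrite expr1n -subr_eq0 opprK -(natrD _ 1 1) pnatr_eq0.
(* Conjugation multiplies [1 - z] by a unit, represented by [e] below. *)
have pic : (1 - z)^* = - z ^+ (N.*2.-1) * (1 - z).
  rewrite -conj_root rmorphB rmorph1 mulrBr mulr1 mulNr [z^* * z]mulrC.
  by rewrite mul_conj_root; ring.
pose e := (- 'X^(N.*2.-1) : {poly int}).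
have eve : ev e = - z ^+ (N.*2.-1).
  by rewrite rmorphN /= map_polyXn hornerN hornerXn.
have normE : 2 ^+ n = (1 - z) ^+ j.*2 * ev e ^+ j * (ev q * ev qc).
  rewrite -normp normCK Dq -addnn exprD eve Dqc; set y := ev q.
  by rewrite rmorphM rmorphXn /= pic exprMn; ring.
(* The factor [a ^+ n] turns [2 ^+ n] into [(1 - z) ^+ (n * N)], after which [(1 - z) ^+ j.*2]
   cancels. At 1 both [e] and [a] are -1. *)
have /horner_intr_eq_mod2 :
    ev (e ^+ j * (q * qc) * a ^+ n) = ev ((1 - 'X) ^+ (n * N - j.*2)).
  have pij0 : (1 - z) ^+ j.*2 != 0 by rewrite expf_neq0.
  apply: (mulfI pij0).
  rewrite [in RHS]rmorphXn rmorphB rmorph1 /= map_polyX [in RHS]horner_exp.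
  rewrite hornerD hornerN hornerX hornerC -exprD subnKC ?(ltnW ltj) // mulnC.
  rewrite exprM Da exprMn normE !(rmorphM, rmorphXn) /= !(hornerM, horner_exp).
  by rewrite !mulrA.
rewrite !(hornerM, horner_exp) qc1 a1 /e !hornerE expr1n subrr expr0n subn_eq0.
rewrite leqNgt ltj subr0 /= dvdzE !abszM !absz_sign muln1 mul1n.
by rewrite Euclid_dvdM // orbb.
Qed.

(** With [j = N * n./2] in [pi_pow_dvd], [two_dvd_pi_pow] makes [ev p] a multiple of [2 ^+ n./2] in
    Z[z]; [horner_intr_inj] carries this over to the coefficients. *)
Lemma two_pow_dvd (n : nat) (p : {poly int}) :
  (size p <= N)%N -> `|ev p| ^+ 2 = 2 ^+ n ->
  exists q : {poly int}, [/\ (size q <= N)%N, p = 2 ^+ n./2 *: q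
                           & `|ev q| ^+ 2 = (2 ^ odd n)%:R].
Proof.
move=> szp normp.
have [|q Dq] := pi_pow_dvd _ _ (N * n./2) normp.
  by rewrite doubleMr mulnC leq_mul2r halfK leq_subr orbT.
have [a Da _] := two_dvd_pi_pow.
have [d [r [_ szr Er]]] := divp_XnD1 (a ^+ n./2 * q).
have Dp : p = 2 ^+ n./2 *: r.
  apply/subr0_eq/horner_intr_inj; rewrite ?Er //.
    apply: leq_trans (size_polyD _ _) _.
    by rewrite size_polyN geq_max szp (leq_trans (size_scale_leq _ _)).
  rewrite rmorphB /= map_polyZ hornerD hornerN hornerZ Er Dq rmorphM /= hornerM.
  rewrite exprM Da exprMn !rmorphXn /= horner_exp rmorph_nat; ring.
exists r; split=> //.
have := normp; rewrite {1}Dp map_polyZ hornerZ normrM exprMn rmorphXn /=.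
rewrite normrX -exprM muln2 ger0_norm ?ler0n //.
rewrite -{2}(odd_double_half n) addnC exprD natrX => /mulfI; apply.
by rewrite expf_neq0 // pnatr_eq0.
Qed.

(** Expand [ev q] times its conjugate on the basis [1, ..., z ^+ N.-1] and compare constant
    coefficients. *)
Lemma sum_sqr_coef (c : nat) (q : {poly int}) :
  (size q <= N)%N -> `|ev q| ^+ 2 = c%:R -> \sum_(i < N) q`_i ^+ 2 = c%:R.
Proof.
move=> szq normq.
(* [t i l] represents z^(i - l) by a polynomial of size at most N. *)
pose t (i l : nat) : {poly int} :=
  if (l <= i)%N then 'X^(i - l) else - 'X^(N - (l - i)).
pose r := \sum_(i < N) \sum_(l < N) (q`_i * q`_l) *: t i l.
have szt (i l : 'I_N) : (size (t i l) <= N)%N.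
  rewrite /t; case: (leqP l i) => [_|lt_il]; rewrite ?size_polyN size_polyXn.
    by rewrite (leq_ltn_trans (leq_subr _ _)).
  by rewrite ltn_subrL subn_gt0 lt_il pow2_gt0.
have evt (i l : 'I_N) : ev (t i l) = z ^+ i * z^* ^+ l.
  rewrite /t; case: (leqP l i) => [le_li|lt_il].
    rewrite map_polyXn hornerXn -{2}(subnK le_li) exprD -mulrA -exprMn.
    by rewrite mul_conj_root expr1n mulr1.
  have lt_liN : (l - i <= N)%N by rewrite (leq_trans (leq_subr _ _)) // ltnW.
  rewrite rmorphN /= map_polyXn hornerN hornerXn.
  have -> : z ^+ i * z^* ^+ l = z^* ^+ (l - i).
    have -> : z^* ^+ l = z^* ^+ i * z^* ^+ (l - i).
      by rewrite -exprD subnKC // ltnW.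
    by rewrite mulrA -exprMn mul_conj_root expr1n mul1r.
  apply: (mulfI (expf_neq0 (l - i) root_neq0)).
  by rewrite mulrN -exprD subnKC // zN1 opprK -exprMn mul_conj_root expr1n.
have r0 : r - c%:R = 0.
  apply: horner_intr_inj.
    apply: leq_trans (size_polyD _ _) _; rewrite size_polyN -polyC_natr.
    rewrite geq_max (leq_trans (size_polyC_leq1 _)) ?pow2_gt0 // andbT.
    apply: leq_trans (size_sum _ _ _) _; apply/bigmax_leqP => i _.
    apply: leq_trans (size_sum _ _ _) _; apply/bigmax_leqP => l _.
    exact: leq_trans (size_scale_leq _ _) _.
  rewrite rmorphB hornerD hornerN rmorph_nat /= -polyC_natr hornerC.
  have szqC : (size (map_poly intr q : {poly C}) <= N)%N.
    exact: leq_trans (size_poly _ _) szq.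
  rewrite -normq normCK (horner_coef_wide _ szqC) rmorph_sum mulr_suml.
  rewrite rmorph_sum horner_sum; apply/eqP; rewrite subr_eq0; apply/eqP.
  apply: eq_bigr => i _; rewrite rmorph_sum horner_sum mulr_sumr /=.
  apply: eq_bigr => l _; rewrite !coef_map /= map_polyZ hornerZ evt !rmorphM.
  by rewrite rmorphXn /= rmorph_int; ring.
have := congr1 (fun p : {poly int} => p`_0) (subr0_eq r0).
rewrite -polyC_natr coefC eqxx coef_sum => <-.
(* Only [l = i] contributes in degree 0: otherwise the exponent in [t i l] is positive. *)
apply: eq_bigr => i _; rewrite coef_sum (bigD1 i) //= big1 => [|l ne_li].
  by rewrite coefZ /t leqnn subnn coefXn mulr1 addr0.
rewrite coefZ /t; case: (leqP l i) => le_li; rewrite ?coefN coefXn.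
  rewrite (eq_sym 0%N) subn_eq0 leqNgt ltn_neqAle le_li andbT.
  rewrite -val_eqE in ne_li.
  by rewrite ne_li mulr0.
rewrite (eq_sym 0%N) subn_eq0 leqNgt (leq_ltn_trans (leq_subr _ _)) //.
by rewrite oppr0 mulr0.
Qed.

Lemma horner_intr_norm_even (n : nat) (p : {poly int}) :
  ~~ odd n -> (size p <= N)%N -> `|ev p| ^+ 2 = 2 ^+ n ->
  exists (j : nat) (b : bool),
    (j < N)%N /\ p = (2 ^+ n./2 * (-1) ^+ b) *: 'X^j.
Proof.
move=> even_n szp normp.
have [q [szq -> normq]] := two_pow_dvd _ _ szp normp.
rewrite (negbTE even_n) expn0 in normq.
have [j [b [_ qj q0]]] :=
  sum_sqr_int_pick _ _ _ 0 isT (sum_sqr_coef 1 _ szq normq).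
exists j, b; split=> //; rewrite -scalerA; congr (_ *: _).
apply/polyP => i; rewrite coefZ coefXn.
have [lt_iN|le_Ni] := ltnP i N; last first.
  rewrite nth_default ?(leq_trans szq) // gtn_eqF ?mulr0 //.
  exact: leq_trans (ltn_ord j) le_Ni.
have [->|ne_ij] := eqVneq i j; first by rewrite qj mulr1.
have := psumr_eq0P _ q0 (i := Ordinal lt_iN).
rewrite mulr0 /= -val_eqE /= ne_ij => /(_ (fun _ _ => sqr_ge0 _) isT)/eqP.
by rewrite sqrf_eq0 => /eqP.
Qed.

(** The two nonzero coefficients of [q] are signs. Their squares already make up the norm 2, so the
    cross term vanishes; this fixes the distance of the two indices. *)
Lemma horner_intr_norm_odd (n : nat) (p : {poly int}) :
  odd n -> (size p <= N)%N -> `|ev p| ^+ 2 = 2 ^+ n ->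
  exists (j : nat) (b1 b2 : bool),
    (j < 2 ^ m.-1)%N /\
    p = (2 ^+ n./2 * (-1) ^+ b1) *: 'X^j
        + (2 ^+ n./2 * (-1) ^+ b2) *: 'X^(j + 2 ^ m.-1).
Proof.
move=> odd_n szp normp.
have [q [szq -> normq]] := two_pow_dvd _ _ szp normp.
rewrite odd_n expn1 in normq.
have [j [b [_ qj q1]]] :=
  sum_sqr_int_pick _ _ _ 1 isT (sum_sqr_coef 2 _ szq normq).
have [l [d [ne_lj ql q0]]] := sum_sqr_int_pick _ _ _ 0 isT q1.
have {q0} q0 (i : nat) : i != j -> i != l -> q`_i = 0.
  move=> ne_ij ne_il; have [lt_iN|le_Ni] := ltnP i N; last first.
    by rewrite nth_default ?(leq_trans szq).
  have := psumr_eq0P _ q0 (i := Ordinal lt_iN).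
  rewrite /= -!val_eqE /= ne_ij ne_il => /(_ (fun _ _ => sqr_ge0 _) isT)/eqP.
  by rewrite sqrf_eq0 => /eqP.
wlog lt_jl : j l b d qj ql q0 ne_lj {q1} / (j < l)%N => [IH|].
  case: (ltngtP j l) => [lt_jl|lt_lj|/val_inj Ejl]; first exact: (IH j l b d).
    apply: (IH l j d b ql qj _ _ lt_lj); last by rewrite eq_sym.
    by move=> i ? ?; apply: q0.
  by rewrite Ejl eqxx in ne_lj.
have Dq : q = (-1) ^+ b *: 'X^j + (-1) ^+ d *: 'X^l.
  apply/polyP => i; rewrite coefD !coefZ !coefXn.
  have [->|ne_ij] := eqVneq i j.
    by rewrite qj (ltn_eqF lt_jl) mulr1 mulr0 addr0.
  have [->|ne_il] := eqVneq i l; first by rewrite ql mulr1 mulr0 add0r.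
  by rewrite q0 // !mulr0 addr0.
pose e := (l - j)%N.
have e_gt0 : (0 < e)%N by rewrite subn_gt0.
have lt_eN : (e < N)%N by rewrite (leq_ltn_trans (leq_subr _ _)).
have zc i : z ^+ i * z^* ^+ i = 1 by rewrite -exprMn mul_conj_root expr1n.
have zcN : z ^+ (N - e) = - z^* ^+ e.
  apply: (mulfI (expf_neq0 e root_neq0)).
  by rewrite mulrN zc -exprD subnKC ?zN1 // ltnW.
have ze0 : z ^+ e + z^* ^+ e = 0.
  have evq : ev q = (-1) ^+ b * z ^+ j + (-1) ^+ d * (z ^+ j * z ^+ e).
    rewrite Dq rmorphD /= !map_polyZ !map_polyXn hornerD !hornerZ !hornerXn.
    by rewrite !rmorph_sign -exprD subnKC // ltnW.
  move: normq; rewrite normCK evq !(rmorphD, rmorphM) /= !rmorph_sign /=.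
  rewrite !rmorphXn /=; set u := z ^+ j; set uc := z^* ^+ j.
  set v := z ^+ e; set vc := z^* ^+ e => Euv.
  have : (-1) ^+ b * (-1) ^+ d * (v + vc) = 0.
    have Ebd : ((-1) ^+ b * (-1) ^+ b) * (u * uc)
        + ((-1) ^+ d * (-1) ^+ d) * (u * uc) * (v * vc)
        + (-1) ^+ b * (-1) ^+ d * (u * uc) * (v + vc) = 2 by rewrite -Euv; ring.
    move: Ebd; rewrite -!signr_addb !addbb !zc !mulr1 => /eqP.
    rewrite -subr_eq0 [_ - _](_ : _ = (-1) ^+ (b (+) d) * (v + vc)); last ring.
    by move/eqP.
  by move/eqP; rewrite -signr_addb mulf_eq0 signr_eq0 => /eqP.
(* By [zcN] the relation [ze0] reads [z ^+ e = z ^+ (N - e)]. Both exponents are below [N], so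
   independence gives [e = N - e]. *)
have He : ('X^e - 'X^(N - e) : {poly int}) = 0.
  apply: horner_intr_inj.
    apply: leq_trans (size_polyD _ _) _.
    by rewrite size_polyN !size_polyXn geq_max lt_eN ltn_subrL e_gt0 pow2_gt0.
  by rewrite rmorphB /= !map_polyXn hornerD hornerN !hornerXn zcN opprK.
have NE : N = (2 ^ m.-1).*2 by rewrite -mul2n -expnS prednK.
have De : (l = j + 2 ^ m.-1 :> nat)%N.
  have := congr1 (fun p : {poly int} => p`_e) He.
  rewrite /= coefB !coefXn eqxx coef0; case: eqP => // Ee _.
  by rewrite /e in Ee lt_eN; lia.
exists j, b, d; rewrite -!scalerA -scalerDr -De; split; last by rewrite Dq.
by have lt_lN : (l < N)%N := ltn_ord l; lia.
Qed.

End CyclotomicIntegers.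

(** * Binary digits and roots of unity *)

Lemma signr_F2D (A : pzRingType) (b c : 'F_2) :
  (-1) ^+ (b + c)%R = (-1) ^+ b * (-1) ^+ c :> A.
Proof.
rewrite -exprD -[LHS]signr_odd -[RHS]signr_odd.
by case: b c => [[|[|?]] ?] [[|[|?]] ?].
Qed.

Lemma F2_natr_even (e : nat) : ~~ odd e -> e%:R = 0 :> 'F_2.
Proof.
move=> even_e; rewrite -(odd_double_half e) (negbTE even_e) add0n -mul2n natrM.
have -> : 2 = 0 :> 'F_2 by apply: val_inj.
exact: mul0r.
Qed.

Lemma F2_natr_val (b : 'F_2) : (b : nat)%:R = b.
Proof. exact: natr_Zp. Qed.

Lemma F2_lt2 (b : 'F_2) : (b < 2)%N.
Proof. by case: b. Qed.

Lemma sum_bits_lt (b : nat -> 'F_2) (t : nat) :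
  (\sum_(1 <= i < t.+1) 2 ^ (i - 1) * b i < 2 ^ t)%N.
Proof.
elim: t => [|t IHt]; first by rewrite big_geq.
rewrite big_nat_recr //= subn1 /= expnS.
have := F2_lt2 (b t.+1); nia.
Qed.

(** The digits numbered below [t] sum to less than [2 ^ (t - 1)]; the remaining terms are multiples
    of it. *)
Lemma sum_bits_divn (b : nat -> 'F_2) [t k : nat] :
  (1 <= t <= k)%N ->
  ((\sum_(1 <= i < k) 2 ^ (i - 1) * b i) %/ 2 ^ (t - 1) =
   \sum_(t <= i < k) 2 ^ (i - t) * b i)%N.
Proof.
case: t => // t /andP[_ le_tk].
rewrite (big_cat_nat (n := t.+1)) //= subn1 /=.
have -> : (\sum_(t.+1 <= i < k) 2 ^ (i - 1) * b i =
           (\sum_(t.+1 <= i < k) 2 ^ (i - t.+1) * b i) * 2 ^ t)%N.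
  rewrite big_distrl /= big_nat [RHS]big_nat.
  apply: eq_bigr => i /andP[lt_ti _].
  by rewrite mulnAC -expnD; congr (2 ^ _ * _)%N; lia.
by rewrite divnDr ?dvdn_mull // divn_small ?sum_bits_lt // mulnK ?expn_gt0.
Qed.

Lemma sum_bits_bit (b : nat -> 'F_2) (t k : nat) :
  (1 <= t < k)%N ->
  ((\sum_(1 <= i < k) 2 ^ (i - 1) * b i) %/ 2 ^ (t - 1))%N%:R = b t.
Proof.
move=> /andP[t0 lt_tk].
have le_tk : (1 <= t <= k)%N by rewrite t0 ltnW.
rewrite (sum_bits_divn b le_tk) (big_ltn lt_tk) subnn mul1n natrD.
rewrite F2_natr_val F2_natr_even; first by rewrite addr0.
rewrite big_nat; elim/big_ind: _ => [|x y ex ey|i /andP[lt_ti _]].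
- by [].
- by rewrite oddD (negbTE ex).
- by rewrite oddM oddX subn_eq0 leqNgt lt_ti.
Qed.

(** Digit [i] of [j], numbered from 1, is the parity of [j %/ 2 ^ (i - 1)]. This makes the linear
    form in [top_bit] a function of the fibre index [j] alone. *)
Definition bit_comb (s : nat) (c : seq 'F_2) (j : nat) : 'F_2 :=
  \sum_(1 <= i < s) ccoord c i * (j %/ 2 ^ (i - 1))%N%:R.

(** The form reads digits 1 to [s - 1], and adding [2 ^ r] leaves the lowest [r] digits alone. *)
Lemma bit_combDpow2 (s : nat) (c : seq 'F_2) (j r : nat) :
  (s <= r.+1)%N -> bit_comb s c (j + 2 ^ r) = bit_comb s c j.
Proof.
move=> le_sr; rewrite /bit_comb big_nat [RHS]big_nat.
apply: eq_bigr => i /andP[i0 lt_is].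
have -> : (2 ^ r = 2 ^ (r - (i - 1)) * 2 ^ (i - 1))%N.
  by rewrite -expnD; congr (2 ^ _)%N; lia.
rewrite addnC divnMDl ?expn_gt0 // natrD F2_natr_even ?add0r // oddX.
by rewrite negb_or subn_eq0 -ltnNge andbT; lia.
Qed.

(** For [s = (size c).+2] the last coefficient multiplies digit [s - 1] of [j], which becomes the
    exponent of the sign between the two transforms. *)
Lemma bit_comb_rcons (c : seq 'F_2) (e : 'F_2) (j : nat) :
  bit_comb (size c).+2 (rcons c e) j =
  bit_comb (size c).+2 (rcons c 0) j + e * (j %/ 2 ^ size c)%N%:R.
Proof.
rewrite /bit_comb ![\sum_(1 <= i < (size c).+2) _]big_nat_recr //= /ccoord.
rewrite !nth_rcons ltnn eqxx mul0r addr0 subn1.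
congr (_ + _); rewrite big_nat [RHS]big_nat.
apply: eq_bigr => i /andP[i0 lt_is]; rewrite !nth_rcons.
by rewrite -ltnS prednK // lt_is.
Qed.

Section Zeta.
Local Open Scope complex_scope.
Variable R : realType.

Lemma zeta_sqr (r : nat) : zeta R r.+1 ^+ 2 = zeta R r.
Proof.
have Ed : 2 * pi / 2 ^+ r = (2 * pi / 2 ^+ r.+1) *+ 2 :> R.
  by rewrite exprS invfM mulrCA -[RHS]mulr_natr [RHS]mulrC mulVKf ?pnatr_eq0.
rewrite /zeta Ed cos_mulr2n sin_mulr2n; set y := 2 * pi / 2 ^+ r.+1.
rewrite expr2; simpc; congr (_ +i* _); last by ring.
by rewrite -[1](cos2Dsin2 y); ring.
Qed.

Lemma zetaXpow2 (r : nat) : zeta R r.+1 ^+ (2 ^ r) = -1.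
Proof.
elim: r => [|r IHr]; last by rewrite expnS exprM zeta_sqr.
rewrite expr1 /zeta expr1 mulrAC mulfV ?pnatr_eq0 // mul1r cospi sinpi.
by apply/eqP; rewrite eq_complex /= oppr0 !eqxx.
Qed.

Lemma zetaX_Zp (r e : nat) :
  (0 < r)%N -> zeta R r ^+ (e%:R : 'Z_(2 ^ r)) = zeta R r ^+ e.
Proof.
case: r => // r _; rewrite val_Zp_nat ?expr_mod //; last first.
  by rewrite -{1}(expn0 2) ltn_exp2l.
by rewrite expnS mulnC exprM zetaXpow2 sqrrN expr1n.
Qed.

Lemma norm_zetaX (r e : nat) : `|zeta R r.+1 ^+ e| = 1.
Proof.
have /eqP : `|zeta R r.+1| ^+ (2 ^ r) = 1 by rewrite -normrX zetaXpow2 normrN1.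
by rewrite normrX pexpr_eq1 ?expn_gt0 // => /eqP ->; rewrite expr1n.
Qed.

(** Squaring clears the real exponent n / 2 and leaves a norm equation in Z[z]. *)
Lemma gbentP (V : vectType 'F_2) (ip : V -> V -> 'F_2) (r : nat)
    (F : V -> 'Z_(2 ^ r)) :
  gbent R ip F <-> forall u, `|gWHT R ip F u| ^+ 2 = 2 ^+ \dim {:V}.
Proof.
pose y : R := 2 `^ ((\dim {:V})%:R / 2).
have y2 : (y%:C) ^+ 2 = 2 ^+ \dim {:V} :> R[i].
  rewrite -rmorphXn /= /y -powR_mulrn ?powR_ge0 // -powRrM divfK ?pnatr_eq0 //.
  by rewrite powR_mulrn // rmorphXn rmorph_nat.
have y0 : 0 <= y%:C by rewrite lecR powR_ge0.
split=> H u; first by rewrite H.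
by apply/eqP; rewrite -(eqrXn2 (n := 2)) // H y2.
Qed.

End Zeta.

(** * Transforms grouped by the low binary digits *)

Section Components.

Variables (V : vectType 'F_2) (ip : V -> V -> 'F_2) (k : nat).
Variable a : seq (V -> 'F_2).

Definition low_bits (x : V) : nat :=
  (\sum_(1 <= i < k) 2 ^ (i - 1) * acoord a i x)%N.

(** The coefficients are the S_j. The digit [a_k] becomes a sign because it adds [2 ^ k.-1] to the
    exponent of [zeta R k]. *)
Definition low_poly (u : V) : {poly int} :=
  \poly_(j < 2 ^ k.-1)
     \sum_(x : finvect_type V | low_bits x == j)
        (-1) ^+ acoord a k x * (-1) ^+ ip u x.

Lemma low_bits_lt (x : V) : (0 < k)%N -> (low_bits x < 2 ^ k.-1)%N.
Proof.
move=> k_gt0; rewrite /low_bits -{1}(prednK k_gt0).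
exact: (sum_bits_lt (fun i => acoord a i x)).
Qed.

(** The weight [w] is free so that one regrouping serves [f] (powers of [zeta R k]), [gcomp]
    ([comp_weight]) and the integer sum of [semibent] (signs). *)
Lemma sum_low_bits (A : comNzRingType) (w : nat -> A) (u : V) :
  (0 < k)%N ->
  \sum_(x : finvect_type V)
     w (low_bits x) * ((-1) ^+ acoord a k x * (-1) ^+ ip u x)
  = \sum_(j < 2 ^ k.-1) ((low_poly u)`_j)%:~R * w j.
Proof.
move=> k_gt0.
pose lo (x : finvect_type V) := Ordinal (low_bits_lt x k_gt0).
rewrite (partition_big lo xpredT) //=; apply: eq_bigr => j _.
rewrite coef_poly ltn_ord rmorph_sum mulr_suml /=.
apply: eq_big => [x|x /eqP <- /=]; first by rewrite -val_eqE.
by rewrite mulrC rmorphM !rmorph_sign.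
Qed.

Lemma top_bitE (s : nat) (c : seq 'F_2) (x : V) :
  (s <= k)%N ->
  top_bit k s a c x = bit_comb s c (low_bits x) + acoord a k x.
Proof.
move=> le_sk; congr (_ + _); rewrite big_nat [RHS]big_nat.
apply: eq_bigr => i /andP[i_gt0 lt_is]; congr (_ * _).
by rewrite (sum_bits_bit (fun i => acoord a i x)) // i_gt0 (leq_trans lt_is).
Qed.

Variable R : realType.

Lemma zeta_half_Xbit (r : nat) (b : 'F_2) :
  zeta R r.+1 ^+ (2 ^ r * b) = (-1) ^+ b.
Proof. by rewrite exprM zetaXpow2. Qed.

Lemma gWHT_of_bits (f : V -> 'Z_(2 ^ k)) (u : V) :
  (0 < k)%N -> (forall x, f x = of_bits k a x) ->
  gWHT R ip f u = (map_poly intr (low_poly u)).[zeta R k].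
Proof.
move=> k_gt0 Df.
rewrite (horner_coef_wide (n := 2 ^ k.-1)); last first.
  exact: leq_trans (size_poly _ _) (size_poly _ _).
under eq_bigr => j _ do rewrite coef_map /=.
rewrite -(sum_low_bits _ (fun j => zeta R k ^+ j)) //.
apply: eq_bigr => x _; rewrite Df /of_bits zetaX_Zp // big_nat_recr //= exprD.
rewrite -/(low_bits x) -mulrA; case: k k_gt0 => // r _.
by rewrite subn1 zeta_half_Xbit.
Qed.

Definition comp_weight (s : nat) (c : seq 'F_2) (j : nat) : R[i] :=
  (-1) ^+ bit_comb s c j * zeta R (k - s).+1 ^+ (j %/ 2 ^ (s - 1)).

Lemma gWHT_gcomp (s : nat) (c : seq 'F_2) (u : V) :
  (1 <= s <= k)%N ->
  gWHT R ip (gcomp k s a c) u =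
  \sum_(j < 2 ^ k.-1) ((low_poly u)`_j)%:~R * comp_weight s c j.
Proof.
move=> /andP[s_gt0 le_sk]; have k_gt0 : (0 < k)%N by apply: leq_trans le_sk.
rewrite -(sum_low_bits _ (comp_weight s c)) //.
apply: eq_bigr => x _; rewrite /gcomp zetaX_Zp ?addn1 // exprD zeta_half_Xbit.
rewrite top_bitE // signr_F2D.
rewrite -(sum_bits_divn (fun i => acoord a i x)) ?s_gt0 //.
by rewrite -/(low_bits x) /comp_weight; ring.
Qed.

End Components.

Lemma sum_coef_scaleXn (A : comNzRingType) (N j : nat) (c : int)
    (w : nat -> A) :
  (j < N)%N ->
  \sum_(i < N) ((c *: 'X^j : {poly int})`_i)%:~R * w i = c%:~R * w j.
Proof.
move=> lt_jN; rewrite (bigD1 (Ordinal lt_jN)) //= big1 => [|i ne_ij].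
  by rewrite coefZ coefXn eqxx mulr1 addr0.
rewrite coefZ coefXn; case: eqP => [Eij|_]; last by rewrite mulr0 mul0r.
by case/eqP: ne_ij; apply: val_inj.
Qed.

Lemma sum_coefD (A : comNzRingType) (N : nat) (p q : {poly int})
    (w : nat -> A) :
  \sum_(i < N) ((p + q)`_i)%:~R * w i =
  \sum_(i < N) (p`_i)%:~R * w i + \sum_(i < N) (q`_i)%:~R * w i.
Proof.
by rewrite -big_split; apply: eq_bigr => i _; rewrite coefD rmorphD mulrDl.
Qed.

(** * Components of a gbent function *)

Section Gbent.

Variables (R : realType) (V : vectType 'F_2) (ip : V -> V -> 'F_2) (k : nat).
Hypothesis k_ge2 : (2 <= k)%N.
Variables (f : V -> 'Z_(2 ^ k)) (a : seq (V -> 'F_2)).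
Hypotheses (gbent_f : gbent R ip f) (Df : forall x, f x = of_bits k a x).

Local Notation n := (\dim {:V}).
Local Notation lp u := (low_poly V ip k a u).

Let k_gt0 : (0 < k)%N := ltnW k_ge2.
Let k1_gt0 : (0 < k.-1)%N. Proof. by rewrite -ltnS prednK. Qed.

Lemma size_low_poly u : (size (lp u) <= 2 ^ k.-1)%N.
Proof. exact: size_poly. Qed.

Lemma zeta_kN1 : zeta R k ^+ (2 ^ k.-1) = -1.
Proof. by rewrite -{1}(prednK k_gt0) zetaXpow2. Qed.

Lemma norm_low_poly u :
  `|(map_poly intr (lp u)).[zeta R k]| ^+ 2 = 2 ^+ n.
Proof.
rewrite -(gWHT_of_bits V ip k a R f u k_gt0 Df).
exact: (gbentP R V ip k f).1.
Qed.

Lemma norm_pow2 (h : nat) : `|2 ^+ h : R[i]| ^+ 2 = 2 ^+ h.*2.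
Proof. by rewrite normrX ger0_norm ?ler0n // -exprM muln2. Qed.

Lemma pow2S_half r : (0 < r)%N -> (2 ^ r.-1 * 2 = 2 ^ r)%N.
Proof. by case: r => // r _; rewrite mulnC -expnS. Qed.

(** That [j] and [B] serve all [c] at once gives both gbentness and the sign relation. For odd [n]
    the two surviving indices differ in digit [k - 1] only, which [bit_comb] does not read since
    [s < k]; both terms thus carry the same sign. *)
Lemma gWHT_gcomp_sign (s : nat) (u : V) :
  (1 <= s <= k)%N -> ~~ odd n \/ (s < k)%N ->
  exists (j : nat) (B : R[i]), `|B| ^+ 2 = 2 ^+ n /\
    forall c, gWHT R ip (gcomp k s a c) u = (-1) ^+ bit_comb s c j * B.
Proof.
move=> hs parity; have /andP[s_gt0 le_sk] := hs.
have [odd_n|even_n] := boolP (odd n); last first.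
  have [j [b [lt_j Dp]]] := horner_intr_norm_even _ _ _ zeta_kN1 k1_gt0 _ _
    even_n (size_low_poly u) (norm_low_poly u).
  exists j, (2 ^+ n./2 * (-1) ^+ b * zeta R (k - s).+1 ^+ (j %/ 2 ^ (s - 1))).
  split=> [|c].
    rewrite !normrM norm_zetaX mulr1 normr_sign mulr1 norm_pow2.
    by rewrite -[in RHS](odd_double_half n) (negbTE even_n).
  rewrite gWHT_gcomp // Dp sum_coef_scaleXn // /comp_weight.
  by rewrite rmorphM rmorphXn rmorph_sign /=; ring.
have lt_sk : (s < k)%N by case: parity => //; rewrite odd_n.
have [j [b1 [b2 [lt_j Dp]]]] := horner_intr_norm_odd _ _ _ zeta_kN1 k1_gt0 _ _
  odd_n (size_low_poly u) (norm_low_poly u).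
(* The ratio of the weights at the two indices. As [y ^+ 2 = -1], a sign plus a sign times [y] has
   squared norm 2. *)
pose y := zeta R (k - s).+1 ^+ (2 ^ (k - s).-1).
have ks_gt0 : (0 < k - s)%N by rewrite subn_gt0.
have y2 : y ^+ 2 = -1 by rewrite -exprM pow2S_half // zetaXpow2.
pose w := zeta R (k - s).+1 ^+ (j %/ 2 ^ (s - 1)).
have w1 : `|w| = 1 by rewrite norm_zetaX.
have y1 : `|y| = 1 by rewrite norm_zetaX.
have yc : y^* = - y.
  have y0 : y != 0 by rewrite -normr_eq0 y1 oner_eq0.
  by apply: (mulfI y0); rewrite -normCK y1 mulrN -expr2 y2 opprK expr1n.
exists j, (2 ^+ n./2 * ((-1) ^+ b1 + (-1) ^+ b2 * y) * w); split=> [|c].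
  rewrite !normrM w1 mulr1 exprMn norm_pow2 normCK rmorphD rmorphM /=.
  rewrite !rmorph_sign yc.
  have -> : ((-1) ^+ b1 + (-1) ^+ b2 * y) * ((-1) ^+ b1 + (-1) ^+ b2 * - y) =
    (-1) ^+ b1 ^+ 2 - (-1) ^+ b2 ^+ 2 * y ^+ 2 by ring.
  rewrite !sqrr_sign y2 -[in RHS](odd_double_half n) odd_n exprD expr1; ring.
have lt_half : (2 ^ k.-1.-1 * 2 = 2 ^ k.-1)%N := pow2S_half _ k1_gt0.
have lt_j1 : (j < 2 ^ k.-1)%N by lia.
have lt_j2 : (j + 2 ^ k.-1.-1 < 2 ^ k.-1)%N by lia.
rewrite gWHT_gcomp // Dp sum_coefD.
rewrite !sum_coef_scaleXn // /comp_weight.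
rewrite bit_combDpow2; last by lia.
have -> : ((j + 2 ^ k.-1.-1) %/ 2 ^ (s - 1) =
           2 ^ (k - s).-1 + j %/ 2 ^ (s - 1))%N.
  have -> : (2 ^ k.-1.-1 = 2 ^ (k - s).-1 * 2 ^ (s - 1))%N.
    by rewrite -expnD; congr (2 ^ _)%N; lia.
  by rewrite addnC divnMDl ?expn_gt0.
rewrite exprD -/y -/w !rmorphM /= !rmorph_sign !rmorphXn /=; ring.
Qed.

Lemma gbent_gcomp (s : nat) (c : seq 'F_2) :
  (1 <= s <= k)%N -> ~~ odd n \/ (s < k)%N -> gbent R ip (gcomp k s a c).
Proof.
move=> hs parity; apply/gbentP => u.
have [j [B [normB ->]]] := gWHT_gcomp_sign s u hs parity.
by rewrite normrM normr_sign mul1r.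
Qed.

Lemma gWHT_gcomp_rcons (s : nat) (c : seq 'F_2) (u : V) :
  (1 <= s <= k)%N -> ~~ odd n \/ (s < k)%N -> s = (size c).+2 ->
  gWHT R ip (gcomp k s a (rcons c 1)) u
    = gWHT R ip (gcomp k s a (rcons c 0)) u \/
  gWHT R ip (gcomp k s a (rcons c 1)) u
    = - gWHT R ip (gcomp k s a (rcons c 0)) u.
Proof.
move=> hs parity Ds; have [j [B [_ HB]]] := gWHT_gcomp_sign s u hs parity.
rewrite !HB Ds bit_comb_rcons mul1r signr_F2D.
set e : 'F_2 := _%:R; rewrite -(signr_odd _ e).
case: (odd _); [right | left]; rewrite ?mulr1 //.
by rewrite expr1 mulrN1 mulNr.
Qed.

(** For [s = k] the weights are signs, so two terms of absolute value [2 ^+ n./2] remain, which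
    either cancel or double. *)
Lemma semibent_gcomp (c : seq 'F_2) :
  odd n -> semibent ip (as_boolean (gcomp k k a c)).
Proof.
move=> odd_n u W.
have [j [b1 [b2 [lt_j Dp]]]] := horner_intr_norm_odd _ _ _ zeta_kN1 k1_gt0 _ _
  odd_n (size_low_poly u) (norm_low_poly u).
have lt_half : (2 ^ k.-1.-1 * 2 = 2 ^ k.-1)%N := pow2S_half _ k1_gt0.
have lt_j1 : (j < 2 ^ k.-1)%N by lia.
have lt_j2 : (j + 2 ^ k.-1.-1 < 2 ^ k.-1)%N by lia.
pose w i : int := (-1) ^+ bit_comb k c i.
have DW : W = \sum_(i < 2 ^ k.-1) ((lp u)`_i)%:~R * w i.
  rewrite -(sum_low_bits V ip k a _ w) //.
  apply: eq_bigr => x _; rewrite as_boolean_gcomp top_bitE // !signr_F2D.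
  by rewrite mulrA.
rewrite DW Dp sum_coefD !sum_coef_scaleXn // !intz /w.
have -> : n.+1./2 = n./2.+1 by rewrite -uphalfE uphalf_half odd_n.
set e1 := bit_comb _ _ _; set e2 := bit_comb _ _ _.
rewrite -!mulrA -mulrDr -(signr_odd _ e1) -(signr_odd _ e2) -!signr_addb.
case: (b1 (+) _); case: (b2 (+) _);
  rewrite /= ?expr1 ?expr0 ?subrr ?addNr ?mulr0 ?normr0;
  try by left.
- by right; rewrite -opprD mulrN normrN exprSr ger0_norm // mulr_ge0 ?exprn_ge0.
- by right; rewrite exprSr ger0_norm // mulr_ge0 ?exprn_ge0.
Qed.

End Gbent.

Theorem theorem4p7 (R : realType) (n : nat) (V : vectType 'F_2)
    (hn : \dim {:V} = n)
    (ip : {symmetric V}) (hip : nondegenerate ip)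
    (k : nat) (hk : (2 <= k)%N)
    (f : V -> 'Z_(2 ^ k)) (hf : gbent R ip f)
    (a : k.-tuple (V -> 'F_2))
    (hfa : forall x : V, f x = of_bits k a x)
    (s : nat) (hs : (1 <= s <= k)%N) :
  (~~ odd n \/ (odd n /\ (s < k)%N) ->
     (forall c : s.-1.-tuple 'F_2, gbent R ip (gcomp k s a c)) /\
     ((2 <= s)%N ->
        forall (c : (s - 2).-tuple 'F_2) (u : V),
          gWHT R ip (gcomp k s a (rcons c 1)) u
            = gWHT R ip (gcomp k s a (rcons c 0)) u \/
          gWHT R ip (gcomp k s a (rcons c 1)) u
            = - gWHT R ip (gcomp k s a (rcons c 0)) u)) /\
  (odd n /\ s = k ->
     forall c : s.-1.-tuple 'F_2, semibent ip (as_boolean (gcomp k s a c))).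
Proof.
have k_ge1 := ltnW hk; have /andP[s_ge1 _] := hs.
rewrite -hn; split=> [parity|[odd_n ->] c]; last first.
  exact: (semibent_gcomp R V ip k hk f a hf hfa).
have {}parity : ~~ odd (\dim {:V}) \/ (s < k)%N.
  by case: parity => [|[]]; [left | right].
split=> [c|s_ge2 c u].
  exact: (gbent_gcomp R V ip k hk f a hf hfa).
apply: (gWHT_gcomp_rcons R V ip k hk f a hf hfa) => //.
by rewrite size_tuple; lia.
Qed.
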